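(* Let $S$ be a semigroup and let $I$ be a right ideal, a left ideal, or a two-sided ideal of $S$. If $S$ satisfies ACCPR, then $I$ (regarded as a semigroup in its own right) satisfies ACCPR.
   Context: For a semigroup $T$, $T^1$ denotes the monoid obtained from $T$ by adjoining an identity if necessary ($T^1=T$ if $T$ is already a monoid). A right ideal of $T$ is a subset $I\subseteq T$ with $IT\subseteq I$; left ideals are defined dually; an ideal (two-sided ideal) is both a right and a left ideal. The principal right ideals of $T$ are the sets $aT^1$, $a\in T$. A semigroup $T$ satisfies ACCPR if every ascending chain $a_1T^1\subseteq a_2T^1\subseteq\cdots$ of principal right ideals of $T$ eventually stabilises. *)

(* Defs.v *)
From HB Require Import structures.
From mathcomp Require Import all_boot boolp classical_sets.

Set Implicit Arguments.
Unset Strict Implicit.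
Unset Printing Implicit Defensive.

Local Open Scope classical_set_scope.
Local Open Scope group_scope.

Section Semigroups.
Variable T : semigroupType.

Definition has_identity : Prop := exists e : T, forall x : T, e * x = x /\ x * e = x.

Definition mul1 (u v : option T) : option T :=
  match u, v with
  | Some x, Some y => Some (x * y)
  | None, _ => v
  | _, None => u
  end.

(* T^1 inside [option T]: [Some x] stands for x, and [None] is the adjoined
   identity, present only when T has no identity of its own. *)
Definition adjoin1 : set (option T) :=
  [set u | u = None -> ~ has_identity].

Definition principal_right_ideal (a : T) : set T :=
  [set b | exists2 u, adjoin1 u & Some b = mul1 (Some a) u].

Definition ACCPR : Prop :=
  forall a : nat -> T,
    (forall n, principal_right_ideal (a n) `<=` principal_right_ideal (a n.+1)) ->
    exists N, forall n, (N <= n)%N ->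
      principal_right_ideal (a n) = principal_right_ideal (a N).

Definition right_ideal (I : set T) : Prop := forall x t : T, I x -> I (x * t).

Definition left_ideal (I : set T) : Prop := forall x t : T, I x -> I (t * x).

Definition two_sided_ideal (I : set T) : Prop := right_ideal I /\ left_ideal I.

Definition some_ideal (I : set T) : Prop :=
  [\/ right_ideal I, left_ideal I | two_sided_ideal I].

Lemma some_ideal_mulg_closed (I : set T) : some_ideal I -> mulg_closed [in I].
Proof.
move=> hI x y xI yI; have Ix := set_mem xI; have Iy := set_mem yI.
apply: mem_set.
by case: hI => [rI|lI|[rI _]]; [exact: rI|exact: lI|exact: rI].
Qed.

(* I as a semigroup in its own right: the subtype {x : T | x \in I} with the
   product restricted from T; [hI] is kept as a parameter so that the semigroup
   structure below can be inferred. *)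
Definition ideal_semigroup (I : set T) (hI : some_ideal I) : Type :=
  {x : T | x \in I}.

HB.instance Definition _ (I : set T) (hI : some_ideal I) :=
  SubChoice.copy (ideal_semigroup hI) {x : T | x \in I}.

HB.instance Definition _ (I : set T) (hI : some_ideal I) :=
  SubChoice_isSubSemigroup.Build T [in I] (ideal_semigroup hI)
    (some_ideal_mulg_closed hI).

Lemma ideal_semigroup_mulE (I : set T) (hI : some_ideal I)
    (x y : ideal_semigroup hI) :
  \val (x * y) = \val x * \val y.
Proof. by []. Qed.

End Semigroups.

(* Main.v *)
Require Import Defs.
From mathcomp Require Import all_boot boolp classical_sets.

(** Write [x <= y] for [x] in [y S^1], i.e. [x = y] or [x] in [y S].  A chain
    [a] of [I] that ascends in [I] also ascends in [S], hence stabilises there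
    from some [N] on: [a m <= a N] in [S] for every [m >= N].  What remains is
    to turn these divisions in [S] into divisions by elements of [I].

    If [a] is eventually constant there is nothing to do.  Otherwise every [m]
    has some [n > m] with [a n <> a m], so that [a m] lies in [a n I].  The
    factor from [I] obtained in this way absorbs the uncontrolled factor from
    [S^1], on the side that the ideal allows.
    - For a right ideal, [x] in [y I] gives [x S^1] contained in [y I]
      (lemma [right_ideal_absorbs]).  Choosing [n > N] with [a N] in [a n I],
      every [a m] with [m >= N] lies in [a N S^1], hence in [a n I], and the
      chain is stable in [I] from [n] on.
    - For a left ideal, [y] in [z S^1] gives [y I] contained in [z I]
      (lemma [left_ideal_absorbs]).  For [m >= N], choosing [n > m] with [a m]
      in [a n I], the division [a n <= a N] in [S] puts [a m] in [a N I], and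
      the chain is stable in [I] from [N] on. *)

Set Implicit Arguments.
Unset Strict Implicit.
Unset Printing Implicit Defensive.

Local Open Scope classical_set_scope.
Local Open Scope group_scope.

Section RightMultiples.
Variable T : semigroupType.

Definition proper_right_multiple (y x : T) : Prop := exists t, x = y * t.

Definition right_multiple (y x : T) : Prop :=
  x = y \/ proper_right_multiple y x.

(** When the identity of [T^1] belongs to [T], the case [x = y] is itself a
    proper multiple, so the two descriptions of [y T^1] agree. *)
Lemma principal_right_idealP (y x : T) :
  principal_right_ideal y x <-> right_multiple y x.
Proof.
split=> [[[t|] _ /= [->]]|[->|[t ->]]]; [by right; exists t|by left| |].
- have [[e he]|noid] := pselect (has_identity T).
    by exists (Some e) => //=; rewrite (he y).2.
  by exists None.
- by exists (Some t).
Qed.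

Lemma right_multiple_trans (y x z : T) :
  right_multiple y x -> right_multiple z y -> right_multiple z x.
Proof.
case=> [->//|[t ->]] [->|[u ->]]; right; first by exists t.
by exists (u * t); rewrite mulgA.
Qed.

Lemma principal_right_ideal_subset (x y : T) :
  principal_right_ideal x `<=` principal_right_ideal y <-> right_multiple y x.
Proof.
split=> [sub|yx z /principal_right_idealP xz].
  by apply/principal_right_idealP/sub/principal_right_idealP; left.
exact/principal_right_idealP/(right_multiple_trans xz).
Qed.

Definition ascending (a : nat -> T) : Prop :=
  forall n, right_multiple (a n.+1) (a n).

Lemma ascending_le (a : nat -> T) : ascending a ->
  forall m n, (m <= n)%N -> right_multiple (a n) (a m).
Proof.
move=> asc m n /subnK <-; elim: (n - m)%N => [|k IHk]; first by left.
exact: right_multiple_trans IHk (asc _).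
Qed.

Lemma ACCPRP :
  ACCPR T <->
  forall a : nat -> T, ascending a ->
    exists N, forall n, (N <= n)%N -> right_multiple (a N) (a n).
Proof.
split=> acc a asc.
  have [n|N stab] := acc a; first exact/principal_right_ideal_subset.
  by exists N => n /stab eqN; apply/principal_right_ideal_subset; rewrite eqN.
have asc' : ascending a by move=> n; apply/principal_right_ideal_subset.
have [N stab] := acc a asc'.
exists N => n leNn; rewrite eqEsubset.
split; apply/principal_right_ideal_subset; first exact: stab.
exact: ascending_le.
Qed.

Definition eventually_constant (a : nat -> T) : Prop :=
  exists m, forall n, (m <= n)%N -> a n = a m.

Lemma ascending_proper (a : nat -> T) :
  ascending a -> ~ eventually_constant a ->
  forall m, exists2 n, (m <= n)%N & proper_right_multiple (a n) (a m).
Proof.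
move=> asc nconst m; apply: contrapT => noproper.
apply: nconst; exists m => n lemn.
have [->//|amn] := ascending_le asc lemn.
by case: noproper; exists n.
Qed.

End RightMultiples.

Section Ideals.
Variables (S : semigroupType) (I : set S) (hI : some_ideal I).
Implicit Types x y z : ideal_semigroup hI.

Lemma right_multiple_val y x :
  right_multiple y x -> right_multiple (\val y) (\val x).
Proof. by case=> [->|[t ->]]; [left|right; exists (\val t)]. Qed.

Lemma proper_right_multiple_lift y x (t : S) :
  I t -> \val x = \val y * t -> proper_right_multiple y x.
Proof.
move=> It xE; exists (exist _ t (mem_set It) : ideal_semigroup hI).
exact: val_inj.
Qed.

(** If [x = y * u] with [u] in [I], then [x * s = y * (u * s)], and [u * s]
    stays in the right ideal [I]. *)
Lemma right_ideal_absorbs y x z : right_ideal I ->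
  proper_right_multiple y x -> right_multiple (\val x) (\val z) ->
  proper_right_multiple y z.
Proof.
move=> rI [u xE] [zE|[s zE]].
  by exists u; rewrite -xE; apply: val_inj.
apply: (@proper_right_multiple_lift _ _ (\val u * s)).
  exact/rI/set_mem/(valP u).
by rewrite zE xE ideal_semigroup_mulE mulgA.
Qed.

(** If [y = z * s] and [x = y * u] with [u] in [I], then [x = z * (s * u)], and
    [s * u] stays in the left ideal [I]. *)
Lemma left_ideal_absorbs y x z : left_ideal I ->
  proper_right_multiple y x -> right_multiple (\val z) (\val y) ->
  proper_right_multiple z x.
Proof.
move=> lI [u xE] [yE|[s yE]].
  by exists u; rewrite xE; congr (_ * _); apply: val_inj.
apply: (@proper_right_multiple_lift _ _ (s * \val u)).
  exact/lI/set_mem/(valP u).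
by rewrite xE ideal_semigroup_mulE yE mulgA.
Qed.

End Ideals.

Theorem corollary3p2 (S : semigroupType) (I : set S) (hI : some_ideal I) :
  ACCPR S -> ACCPR (ideal_semigroup hI).
Proof.
move=> /ACCPRP accS; apply/ACCPRP => a asc.
have [[m cst]|nconst] := pselect (eventually_constant a).
  by exists m => n /cst ->; left.
have proper := ascending_proper asc nconst.
have [n|N stab] := accS (fun n => \val (a n)).
  exact/right_multiple_val/asc.
have [rI|lI] : right_ideal I \/ left_ideal I.
  by case: (hI) => [rI|lI|[rI _]]; [left|right|left].
- have [n leNn aNn] := proper N.
  exists n => m lenm; right.
  exact: right_ideal_absorbs rI aNn (stab m (leq_trans leNn lenm)).
- exists N => m leNm; right.
  have [n lemn amn] := proper m.
  exact: left_ideal_absorbs lI amn (stab n (leq_trans leNm lemn)).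
Qed.
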